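(* For any $r>0$, any $n\ge1$ and any $\gamma>0$ (with $\delta=\frac1n\ln\gamma$), there exists an $n$-dimensional lattice $\Lambda$ with NLD $\delta$ whose average (and maximal) error probability over the real scalar fast fading channel described in the context satisfies $$P_e(\Lambda)\le\Pr\{\|\mathbf z\|>r\}+E\left\{\frac{V_n\gamma r^n}{\det(\mathbf H)}\right\}=\Pr\{\|\mathbf z\|>r\}+E\left\{\left(\frac{r}{r_{\mathrm{eff}}(\mathbf H)}\right)^n\right\},$$ where $V_n$ is the volume of the unit ball in $\mathbb R^n$ and $r_{\mathrm{eff}}(\mathbf H)$ is defined by $V_nr_{\mathrm{eff}}^n(\mathbf H)=\gamma^{-1}\det(\mathbf H)$.
   Context: Channel: $\mathbf y=\mathbf H\mathbf x+\mathbf z$, $\mathbf H=\mathrm{diag}(H_1,\dots,H_n)$ with $H_i$ i.i.d. positive fading coefficients, $\mathbf z\sim N(0,\sigma^2I_n)$ independent of $\mathbf H$; receiver knows $\mathbf H$. A lattice $\Lambda\subset\mathbb R^n$ with generator matrix $G_\Lambda$ has density $\gamma=1/|\det G_\Lambda|$ and NLD $\frac1n\ln\gamma$. The error probability of the lattice given $\mathbf H$ is the ML error probability of a transmitted lattice point, i.e. the probability that $\mathbf H\lambda+\mathbf z$ leaves the Voronoi cell of $\mathbf H\lambda$ in $\mathbf H\Lambda$ (the same for all $\lambda$); $P_e(\Lambda)$ is its expectation over $\mathbf H$. *)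

(* Defs.v *)
From HB Require Import structures.
From mathcomp Require Import all_boot all_order all_algebra.
From mathcomp Require Import all_classical all_reals all_analysis.
From mathcomp Require Import normal_distribution.
Set Implicit Arguments. Unset Strict Implicit. Unset Printing Implicit Defensive.
Import Order.TTheory GRing.Theory Num.Theory.
Local Open Scope classical_set_scope.
Local Open Scope ring_scope.

Section Defs.
Variable R : realType.

Definition enorm (n : nat) (v : 'I_n -> R) : R := Num.sqrt (\sum_i v i ^+ 2).

Definition lattice_pt (n : nat) (G : 'M[R]_n) (k : 'I_n -> int) : 'I_n -> R :=
  fun i => \sum_j G i j * (k j)%:~R.

Definition lattice (n : nat) (G : 'M[R]_n) : set ('I_n -> R) :=
  [set x | exists k : 'I_n -> int, x = lattice_pt G k].

Definition lattice_density (n : nat) (G : 'M[R]_n) : R := `|\det G|^-1.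

Definition diag_act (n : nat) (h v : 'I_n -> R) : 'I_n -> R := fun i => h i * v i.

Definition voronoi (n : nat) (L : set ('I_n -> R)) (p : 'I_n -> R) : set ('I_n -> R) :=
  [set x | forall q, L q -> enorm (fun i => x i - p i) <= enorm (fun i => x i - q i)].

(* ML decoding error event when lam is sent: y = H lam + z leaves the Voronoi
   cell of H lam in H Lambda *)
Definition error_event (T : Type) (n : nat) (G : 'M[R]_n)
  (H z : 'I_n -> T -> R) (lam : 'I_n -> R) : set T :=
  [set w | ~ voronoi (diag_act (fun i => H i w) @` lattice G)
                     (diag_act (fun i => H i w) lam)
                     (fun i => diag_act (fun i => H i w) lam i + z i w)].

Definition mutually_independent d (T : measurableType d) (P : probability T R)
  (I : finType) (X : I -> T -> R) : Prop :=
  forall B : I -> set R, (forall i, measurable (B i)) ->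
    P (\bigcap_i (X i @^-1` B i)) = (\prod_i fine (P (X i @^-1` B i)))%:E.

Definition channel_rvs (T : Type) (n : nat) (H z : 'I_n -> T -> R) :
  'I_n + 'I_n -> T -> R :=
  fun j => match j with inl i => H i | inr i => z i end.

Fixpoint iint (n : nat) (f : seq R -> \bar R) : \bar R :=
  match n with
  | 0 => f [::]
  | m.+1 => (\int[lebesgue_measure]_x iint m (fun s => f (x :: s)))%E
  end.

Definition ball_vol (n : nat) : R :=
  fine (iint n (fun s => (\1_[set s : seq R | \sum_(x <- s) x ^+ 2 <= 1] s)%:E)).

(* effective radius: V_n r_eff^n = gamma^-1 det H *)
Definition r_eff (n : nat) (gamma detH : R) : R :=
  powR (detH / (gamma * ball_vol n)) n%:R^-1.

End Defs.

(* Main.v *)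
(* Minkowski-Hlawka averaging over the mod-p lattices
   alpha {x in Z^n | x_i = u_i x_0 (mod p)}.  Fix M and call the fading bad when
   some H_i lies outside ]1/M, M].  If |z| <= r, the fading is good and
   alpha p >= 2 r M, then a point alpha y confusable with 0 has |y_i| < p, and
   each such nonzero y lies in at most one of the p^(n-1) lattices.  Hence some
   u has confusion probability at most p^(1-n) times the expected number of grid
   points y with |alpha H y - z| <= r, and comparing volumes of cells with a
   ball bounds this number by V_n (r + n alpha M)^n / (alpha^n det H).
   The normalisation alpha^n p^(n-1) = 1/gamma turns the bound into
   P(|z| > r) + P(bad) + gamma V_n (r + n alpha M)^n E[1_{|z| <= r} / det H].
   Since P(|z| > r) > 0, the last expectation is strictly smaller than
   E[1 / det H] when the latter is finite, and this gap absorbs P(bad) and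
   n alpha M once M and p are large.  In dimension 1, where alpha does not tend
   to 0, the bound is Markov's inequality. *)
Require Import Defs.
From HB Require Import structures.
From mathcomp Require Import all_boot all_order all_algebra.
From mathcomp Require Import all_classical all_reals all_analysis.
From mathcomp Require Import normal_distribution.
From mathcomp Require Import measurable_realfun.
From mathcomp Require Import lra ring zify.
Set Implicit Arguments. Unset Strict Implicit. Unset Printing Implicit Defensive.
Import Order.TTheory GRing.Theory Num.Theory.
Local Open Scope classical_set_scope.
Local Open Scope ring_scope.

(** Both sides are suprema over the simple functions below the integrand, so the comparison applies
    to the inner integrals of [iint], about whose measurability nothing is known. *)
Lemma ge0_le_integral_lower d (T : measurableType d) (R : realType)
    (mu : {measure set T -> \bar R}) (f g : T -> \bar R) :
  (forall x, 0 <= f x)%E -> (forall x, f x <= g x)%E ->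
  (\int[mu]_x f x <= \int[mu]_x g x)%E.
Proof.
move=> f0 fg; rewrite !ge0_integralTE//; last first.
  by move=> x; exact: le_trans (fg x).
apply: ereal_sup_le => y [h /= hf hy]; exists h => // x.
exact: le_trans (fg x).
Qed.

(** * Iterated Lebesgue integrals: upper and lower bounds *)

Section iterated_integral.
Variable R : realType.

Lemma iint_ge0 n (f : seq R -> \bar R) :
  (forall s, 0 <= f s)%E -> (0 <= iint n f)%E.
Proof.
by elim: n f => [|n IHn] f f0 //=; apply: integral_ge0 => x _; exact: IHn.
Qed.

Lemma iint0 n (f : seq R -> \bar R) :
  (forall s, size s = n -> f s = 0%E) -> iint n f = 0%E.
Proof.
elim: n f => [|n IHn] f f0 /=; first exact: f0.
by apply: integral0_eq => x _; apply: IHn => s sn; rewrite f0//= sn.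
Qed.

(** Each coordinate contributes at most 2, the length of [-1, 1]. This serves to show that the unit
    ball has finite volume. *)
Lemma iint_le_cube n (f : seq R -> \bar R) :
  (forall s, 0 <= f s)%E -> (forall s, f s <= 1)%E ->
  (forall s, has (fun x => 1 < `|x|) s -> f s = 0%E) ->
  (iint n f <= (2 ^+ n)%:E)%E.
Proof.
elim: n f => [|n IHn] f f0 f1 fcube /=; first exact: f1.
have -> : (2 ^+ n.+1)%:E =
    (\int[@lebesgue_measure R]_x ((2 ^+ n)%:E * (\1_(`[-1, 1]%classic) x)%:E))%E.
  rewrite ge0_integralZl//=.
  - rewrite integral_indic//= setIT lebesgue_measure_itv/= lte_fin ifT; last lra.
    rewrite -EFinB -EFinM; congr EFin; rewrite exprSr; congr (_ * _); lra.
  - by apply/measurable_EFinP; exact: measurable_indic.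
apply: ge0_le_integral_lower => x; first exact: iint_ge0.
rewrite indicE; have [x1|x1] := boolP (x \in `[-1, 1]%classic).
  rewrite mule1; apply: IHn => // s sx.
  by apply: fcube; rewrite /= sx orbT.
rewrite mule0 iint0// => s _; apply: fcube => /=.
apply/orP; left; rewrite ltNge ler_norml; apply: contra x1.
by move=> x1; rewrite inE/= in_itv.
Qed.

Lemma sum_tuple_cons (V : nmodType) K n (g : n.+1.-tuple 'I_K -> V) :
  \sum_t g t = \sum_(j < K) \sum_(t : n.-tuple 'I_K) g (cons_tuple j t).
Proof.
rewrite pair_big/=.
rewrite (reindex (fun q : 'I_K * n.-tuple 'I_K => cons_tuple q.1 q.2))//=.
exists (fun t => (thead t, behead_tuple t)) => [[j t]|t] _ /=.
  by rewrite theadE; congr (_, _); exact/val_inj.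
by rewrite [RHS]tuple_eta; exact/val_inj.
Qed.

(* The inner iterated integrals need not be measurable, so the lower bound goes
   through step functions only. *)
Lemma iint_ge_cells K n (b c : nat -> R) (f : seq R -> \bar R)
    (g : n.-tuple 'I_K -> R) :
  (forall i, 0 < b i) -> (forall s, 0 <= f s)%E -> (forall t, 0 <= g t) ->
  (forall s (t : n.-tuple 'I_K), size s = n ->
    (forall i, (i < n)%N -> c i + b i * (nth 0%N (map val t) i)%:R <= nth 0 s i
       < c i + b i * (nth 0%N (map val t) i).+1%:R) ->
    ((g t)%:E <= f s)%E) ->
  (((\prod_(i < n) b i) * \sum_t g t)%:E <= iint n f)%E.
Proof.
elim: n b c f g => [|n IHn] b c f g b0 f0 g0 gf.
  rewrite big_ord0 mul1r /= (big_pred1 [tuple])//.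
    by apply: gf.
  by move=> t; apply/esym/eqP/tuple0.
(* [a j] bounds the inner integral from below when the first coordinate lies in [I j]. The half-open
   [I j] are disjoint, so the step function with these values stays below the integrand. *)
pose a j := (\prod_(i < n) b i.+1) *
            \sum_(t : n.-tuple 'I_K) g (cons_tuple j t).
pose I (j : 'I_K) := `[c 0%N + b 0%N * j%:R, c 0%N + b 0%N * j.+1%:R[%classic.
have a0 j : 0 <= a j.
  apply: mulr_ge0; first by apply: prodr_ge0 => i _; exact/ltW.
  exact: sumr_ge0.
have ifge x j : I j x -> ((a j)%:E <= iint n (fun s => f (x :: s)))%E.
  move=> xj; apply: (IHn (b \o S) (c \o S)) => // [i|s t sn tcell]; first exact: b0.
  apply: gf => [|[|i]]/=; first by rewrite sn.
    by move=> _; move: xj; rewrite /I /= in_itv.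
  by rewrite ltnS => /tcell.
have mI j : measurable_fun setT (fun x => (\1_(I j) x)%:E : \bar R).
  apply/measurable_EFinP; apply: measurable_indic; exact: measurable_itv.
have intI j : (\int[@lebesgue_measure R]_x ((a j)%:E * (\1_(I j) x)%:E) =
    (a j * b 0%N)%:E)%E.
  rewrite ge0_integralZl//; [|exact: mI|by rewrite lee_fin].
  rewrite integral_indic; [|exact: measurableT|exact: measurable_itv].
  rewrite setIT /= lebesgue_measure_itv/=.
  rewrite lte_fin ltrD2l ltr_pM2l// ltr_nat ltnSn -EFinB -EFinM.
  by congr EFin; congr (_ * _); rewrite -natr1; ring.
have -> : (\prod_(i < n.+1) b i * \sum_t g t)%:E =
   (\int[@lebesgue_measure R]_x \sum_(j < K) ((a j)%:E * (\1_(I j) x)%:E))%E.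
  rewrite ge0_integral_sum//=.
  - rewrite [RHS](eq_bigr (fun j => (a j * b 0%N)%:E))//.
    rewrite sumEFin; congr EFin; rewrite -mulr_suml /a -mulr_sumr.
    by rewrite sum_tuple_cons big_ord_recl -mulrA mulrC.
  - by move=> j; apply: measurable_funeM; exact: mI.
  - by move=> j x _; rewrite -EFinM lee_fin mulr_ge0.
apply: ge0_le_integral_lower => x.
  by apply: sume_ge0 => j _; rewrite -EFinM lee_fin mulr_ge0.
have [[j xj]|nx] := pselect (exists j, I j x); last first.
  rewrite big1 ?iint_ge0// => j _; rewrite indicE memNset ?mule0// => xj.
  by apply: nx; exists j.
rewrite (bigD1 j)//= big1 => [|k kj].
  by rewrite adde0 indicE mem_set// mule1; exact: ifge.
rewrite indicE memNset ?mule0// => xk; move/negP: kj; apply; apply/eqP/val_inj.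
have aux (k1 k2 : 'I_K) : I k1 x -> I k2 x -> (k1 <= k2)%N.
  rewrite /I /= !in_itv/= => /andP[h1 _] /andP[_ h2].
  by have := le_lt_trans h1 h2; rewrite ltrD2l ltr_pM2l// ltr_nat.
by apply/eqP; rewrite eqn_leq !aux.
Qed.

End iterated_integral.

(** * The volume of the unit ball and the count of grid points in a ball *)

Section ball_volume.
Variable R : realType.

(** The ball lies in the cube [-1, 1]^n, so the iterated integral is finite and [fine] does not
    collapse it to 0. *)
Lemma ball_volE n :
  (ball_vol R n)%:E =
  iint n (fun s => (\1_[set s : seq R | \sum_(x <- s) x ^+ 2 <= 1] s)%:E).
Proof.
rewrite /ball_vol fineK// ge0_fin_numE; last by apply: iint_ge0.
apply: le_lt_trans (ltry (2 ^+ n)); apply: iint_le_cube => // s.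
  by rewrite lee_fin indicE; case: (_ \in _).
move=> /hasP[x xs x1]; rewrite indicE memNset//= => /(le_trans _) sle1.
suff : 1 < \sum_(y <- s) y ^+ 2 by rewrite ltNge sle1.
rewrite (big_rem x)//=; apply: (@lt_le_trans _ _ (x ^+ 2)).
  by rewrite -real_normK ?num_real// exprn_egt1.
by rewrite lerDl; apply: sumr_ge0 => y _; exact: sqr_ge0.
Qed.

(** Each grid point in the ball of radius [r] is the corner of a cell with sides at most [e]. These
    cells are disjoint and lie in the ball of radius r + n e; dividing by that radius moves them
    into the unit ball. *)
Lemma prod_grid_count_le_ball_vol n K (r e : R) (b c : nat -> R) :
  0 < r -> 0 <= e -> (forall i, 0 < b i <= e) ->
  \prod_(i < n) b i *
    \sum_(t : n.-tuple 'I_K)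
      (\sum_(i < n) (c i + b i * (tnth t i)%:R) ^+ 2 <= r ^+ 2)%R%:R <=
  ball_vol R n * (r + n%:R * e) ^+ n.
Proof.
move=> r0 e0 be; pose p := r + n%:R * e.
have p0 : 0 < p by rewrite ltr_wpDr// mulr_ge0.
rewrite -ler_pdivrMr ?exprn_gt0// mulrAC.
have -> : (\prod_(i < n) b i) / p ^+ n = \prod_(i < n) (b i / p).
  by rewrite big_split/= prodr_const card_ord exprVn.
rewrite -lee_fin ball_volE.
apply: (@iint_ge_cells _ _ _ (fun i => b i / p) (fun i => c i / p)) => [i|s|//|].
- by rewrite divr_gt0//; case/andP: (be i).
- by rewrite lee_fin.
move=> s t sn cell; case: (boolP (_ <= _)) => tr; last by rewrite lee_fin.
rewrite indicE mem_set//= (big_nth 0) sn big_mkord.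
pose v (i : 'I_n) := c i + b i * (tnth t i)%:R.
have vr i : `|v i| <= r.
  rewrite -ler_sqr ?nnegrE ?(ltW r0)//= real_normK ?num_real//.
  apply: le_trans tr; rewrite (bigD1 i)//= lerDl.
  by apply: sumr_ge0 => j _; exact: sqr_ge0.
(* A point of the cell exceeds its corner by at most [e] in each coordinate, and the corner has
   coordinates at most [r] in absolute value. *)
have sv (i : 'I_n) : (s`_i * p) ^+ 2 <= v i ^+ 2 + (2 * r * e + e ^+ 2).
  have := cell i (ltn_ord i).
  rewrite (nth_map (tnth t i)) ?size_tuple// -tnth_nth => /andP[s1 s2].
  have bi := be i; have vi := vr i.
  have {}s1 : v i <= s`_i * p.
    by rewrite -ler_pdivrMr// /v mulrDl mulrAC.
  have {}s2 : s`_i * p <= v i + b i.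
    rewrite -ler_pdivlMr// (le_trans (ltW s2))// le_eqVlt; apply/orP; left.
    by apply/eqP; rewrite /v -natr1; ring.
  move: vi; rewrite ler_norml => /andP[v1 v2]; move: bi => /andP[b0 b1].
  pose w := s`_i * p - v i; have -> : s`_i * p = v i + w by rewrite /w; ring.
  have w0 : 0 <= w by rewrite /w; lra.
  have we : w <= e by rewrite /w; lra.
  rewrite sqrrD -addrA lerD2l; apply: lerD; last by rewrite ler_sqr// nnegrE.
  by rewrite -mulr_natl -mulrA ler_pM2l//; nra.
have sqp : \sum_(i < n) (s`_i * p) ^+ 2 <= p ^+ 2.
  apply: (@le_trans _ _ (\sum_(i < n) (v i ^+ 2 + (2 * r * e + e ^+ 2)))).
    exact: ler_sum.
  rewrite big_split/= sumr_const card_ord -[_ *+ n]mulr_natl.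
  apply: (@le_trans _ _ (r ^+ 2 + n%:R * (2 * r * e + e ^+ 2))).
    by rewrite lerD2r.
  (* With n <= n^2 the accumulated error n (2 r e + e^2) is at most [p ^+ 2 - r ^+ 2]. *)
  have nn : n%:R <= n%:R * n%:R :> R.
    by rewrite -natrM ler_nat; case: (n) => // m; rewrite leq_pmulr.
  have -> : p ^+ 2 = r ^+ 2 + (n%:R * (2 * r * e) + (n%:R * n%:R) * e ^+ 2).
    by rewrite /p; ring.
  by rewrite lerD2l mulrDr lerD2l ler_wpM2r// sqr_ge0.
rewrite -(ler_pM2r (exprn_gt0 2 p0)) mul1r mulr_suml.
by under eq_bigr do rewrite -exprMn.
Qed.

(** A single grid point at the origin, with [r] and [e] equal to 1, already gives 1 <= V_n (1 +
    n)^n. *)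
Lemma ball_vol_gt0 n : 0 < ball_vol R n.
Proof.
have := @prod_grid_count_le_ball_vol n 1 1 1 (fun=> 1) (fun=> 0) ltr01 ler01.
rewrite lexx ltr01 => /(_ (fun=> isT)); rewrite big1// mul1r.
rewrite (bigD1 [tuple of nseq n ord0])//= big1 => [|i _]; last first.
  by rewrite (tnth_nth ord0) nth_nseq ltn_ord /= mulr0 addr0 expr0n.
rewrite expr1n ler01 => le1; have : 0 < ball_vol R n * (1 + n%:R * 1) ^+ n.
  apply: lt_le_trans le1; rewrite ltr_wpDr//.
  by apply: sumr_ge0 => t _; exact: ler0n.
by rewrite pmulr_lgt0// exprn_gt0// ltr_wpDr.
Qed.

(** The single cell [-1, 1[ fills the ball up to an endpoint. The factor 2 is what the Markov bound
    in dimension 1 consumes. *)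
Lemma ball_vol1 : 2 <= ball_vol R 1.
Proof.
rewrite -lee_fin ball_volE.
have := @iint_ge_cells R 1 1 (fun=> 2) (fun=> -1)
  (fun s => (\1_[set s : seq R | \sum_(x <- s) x ^+ 2 <= 1] s)%:E) (fun=> 1).
rewrite big_ord1 sumr_const card_tuple card_ord mulr1; apply => //.
move=> [|x [|//]]// t _ /(_ 0%N isT).
rewrite (nth_map ord0) ?size_tuple// ord1 /= mulr0 addr0 mulr1 => /andP[x1 x2].
rewrite indicE mem_set//= big_seq1 -real_normK ?num_real// expr_le1// ler_norml x1.
by lra.
Qed.

End ball_volume.

(** * Lattices defined by congruences mod p, and averaging over them *)

Section modular_lattice.
Variables (R : realType) (m p : nat).
Implicit Types (u : {ffun 'I_m -> 'I_p}) (x : 'I_m.+1 -> int).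

(* The lattice alpha * {x in Z^(m+1) | x_i = u_i x_0 (mod p) for i > 0}. *)
Definition modular_gen (alpha : R) u : 'M[R]_m.+1 :=
  \matrix_(i, j) (alpha *
    (if unlift ord0 j is Some _ then p * (i == j)
     else if unlift ord0 i is Some i' then u i' else 1)%N%:R).

(** Membership in the unscaled lattice of [u], restricted to points with x_0 invertible mod p,
    because [u] can be recovered from such points. *)
Definition modular_class u x : bool :=
  ~~ (p %| x ord0)%Z &&
  [forall i, (p %| x (lift ord0 i) - x ord0 * (u i : nat)%:Z)%Z].

Lemma det_modular_gen alpha u :
  \det (modular_gen alpha u) = alpha ^+ m.+1 * p%:R ^+ m.
Proof.
rewrite det_trig; last first.
  apply/is_trig_mxP => i j ij; rewrite mxE; case: unliftP => [j' ej|ej].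
    have /negbTE-> : i != j by rewrite -val_eqE neq_ltn ij.
    by rewrite muln0 mulr0.
  by move: ij; rewrite ej.
rewrite big_ord_recl mxE unlift_none mulr1 exprS -mulrA; congr (_ * _).
rewrite (eq_bigr (fun=> alpha * p%:R)) ?prodr_const ?card_ord ?exprMn// => i _.
by rewrite mxE liftK eqxx muln1.
Qed.

Lemma modular_gen_pt0 alpha u k :
  lattice_pt (modular_gen alpha u) k ord0 = alpha * (k ord0)%:~R.
Proof.
rewrite /lattice_pt big_ord_recl big1 ?addr0 => [|j _].
  by rewrite mxE unlift_none mulr1.
by rewrite mxE liftK muln0 mulr0 mul0r.
Qed.

Lemma modular_gen_pt_lift alpha u k (i : 'I_m) :
  lattice_pt (modular_gen alpha u) k (lift ord0 i) =
  alpha * (k ord0 * (u i : nat)%:Z + p%:Z * k (lift ord0 i))%:~R.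
Proof.
rewrite /lattice_pt big_ord_recl (bigD1 i)//= big1 => [|j ji]; last first.
  rewrite mxE liftK (inj_eq lift_inj) eq_sym (negbTE ji).
  by rewrite muln0 mulr0 mul0r.
rewrite !mxE !liftK unlift_none eqxx muln1 addr0.
by rewrite rmorphD/= !rmorphM/=; ring.
Qed.

Definition modular_coord u (k : 'I_m.+1 -> int) : 'I_m.+1 -> int :=
  fun i => if unlift ord0 i is Some i'
    then k ord0 * (u i' : nat)%:Z + p%:Z * k i else k ord0.

Lemma modular_gen_pt alpha u k i :
  lattice_pt (modular_gen alpha u) k i = alpha * (modular_coord u k i)%:~R.
Proof.
rewrite /modular_coord; case: unliftP => [j ->|->].
  exact: modular_gen_pt_lift.
exact: modular_gen_pt0.
Qed.

Hypothesis p_prime : prime p.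

Lemma dvdz_small (a : int) : `|a| < p%:Z -> (p %| a)%Z -> a = 0.
Proof.
move=> ap pa; apply/eqP; rewrite -absz_eq0; case: eqP => // /eqP a0.
by have := dvdn_leq _ pa; rewrite lt0n a0 => /(_ isT); lia.
Qed.

(** If p divides x_0, then x_0 = 0 by size; the other coordinates are then multiples of p, hence 0
    as well. So a nonzero small point has x_0 invertible. *)
Lemma modular_class_coord u k :
  (exists i, modular_coord u k i != 0) ->
  (forall i, `|modular_coord u k i| < p%:Z) ->
  modular_class u (modular_coord u k).
Proof.
move=> [i xi0] xp; rewrite /modular_class.
have x0 : modular_coord u k ord0 = k ord0 by rewrite /modular_coord unlift_none.
have xl j : modular_coord u k (lift ord0 j) =
    k ord0 * (u j : nat)%:Z + p%:Z * k (lift ord0 j).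
  by rewrite /modular_coord liftK.
apply/andP; split; last first.
  apply/forallP => j; rewrite xl x0 addrAC subrr add0r.
  exact: dvdz_mulr.
apply: contra xi0 => /(dvdz_small (xp ord0)) k0.
apply/eqP/dvdz_small; first exact: xp.
case: (unliftP ord0 i) => [j ->|->]; last by rewrite k0.
by rewrite xl -x0 k0 mul0r add0r dvdz_mulr.
Qed.

(** Subtracting the congruences gives p | x_0 (u_i - u'_i); x_0 is coprime to p and the difference
    is smaller than p. *)
Lemma modular_class_inj u u' x :
  modular_class u x -> modular_class u' x -> u = u'.
Proof.
move=> /andP[x0 /forallP xu] /andP[_ /forallP xu']; apply/ffunP => i.
have : (p %| x ord0 * ((u i : nat)%:Z - (u' i : nat)%:Z))%Z.
  have -> : x ord0 * ((u i : nat)%:Z - (u' i : nat)%:Z) =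
     (x (lift ord0 i) - x ord0 * (u' i : nat)%:Z) -
     (x (lift ord0 i) - x ord0 * (u i : nat)%:Z) by ring.
  exact: rpredB.
rewrite Gauss_dvdzr; last by rewrite /coprimez /gcdz; move: x0; rewrite /dvdz/= -prime_coprime.
have ui := ltn_ord (u i); have ui' := ltn_ord (u' i).
move=> /dvdz_small uu; apply/val_inj => /=.
have /uu : `|(u i : nat)%:Z - (u' i : nat)%:Z| < p%:Z by lia.
lia.
Qed.

(** Pigeonhole over the p^m choices of [u]: each [t] belongs to at most one class, so the class
    weights add up to at most the total weight. *)
Lemma exists_light_class (I : finType) (x : I -> 'I_m.+1 -> int) (w : I -> R) :
  (forall t, 0 <= w t) ->
  exists u, p%:R ^+ m * (\sum_(t | modular_class u (x t)) w t) <= \sum_t w t.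
Proof.
move=> w0; apply: contrapT => noexists.
have lt u : \sum_t w t < p%:R ^+ m * (\sum_(t | modular_class u (x t)) w t).
  by rewrite ltNge; apply/negP => ?; apply: noexists; exists u.
have u0 : {ffun 'I_m -> 'I_p} := [ffun=> Ordinal (prime_gt0 p_prime)].
have : \sum_(u : {ffun 'I_m -> 'I_p}) \sum_t w t <
    \sum_(u : {ffun 'I_m -> 'I_p})
      p%:R ^+ m * (\sum_(t | modular_class u (x t)) w t).
  apply: ltr_sum; last by [].
  by apply/hasP; exists u0; rewrite ?mem_index_enum.
rewrite sumr_const card_ffun !card_ord -[_ *+ _]mulr_natl natrX -mulr_sumr.
rewrite ltr_pM2l ?exprn_gt0 ?ltr0n ?prime_gt0//; apply/negP; rewrite -leNgt.
rewrite (exchange_big_dep predT)//=; apply: ler_sum => t _.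
case: (pickP (fun u => modular_class u (x t))) => [u ut|none].
  rewrite (big_pred1 u)// => u' /=; apply/idP/eqP => [|->//].
  by move=> u't; exact: modular_class_inj u't ut.
by rewrite big_pred0.
Qed.

End modular_lattice.

(** * Measurability of comparison events and a finite union bound *)

Section measurability.
Context d (T : measurableType d) (R : realType).

Lemma measurable_lt_set (f g : T -> R) :
  measurable_fun setT f -> measurable_fun setT g ->
  measurable [set w | f w < g w].
Proof.
move=> mf mg; have := measurable_fun_ltr mf mg.
by move=> /(_ measurableT [set true] I); rewrite setTI.
Qed.

Lemma measurable_le_set (f g : T -> R) :
  measurable_fun setT f -> measurable_fun setT g ->
  measurable [set w | f w <= g w].
Proof.
move=> mf mg; have := measurable_fun_ler mf mg.
by move=> /(_ measurableT [set true] I); rewrite setTI.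
Qed.

Lemma measurable_invr_gt0 (f : T -> R) :
  (forall w, 0 < f w) -> measurable_fun setT f ->
  measurable_fun setT (fun w => (f w)^-1).
Proof.
move=> f0 mf; under eq_fun do rewrite -powR_inv1 ?ltW//.
exact: measurableT_comp (measurable_powR _) mf.
Qed.

Lemma measure_bigsetU_le (mu : {measure set T -> \bar R}) (J : Type)
    (s : seq J) (Q : pred J) (C : J -> set T) :
  (forall t, measurable (C t)) ->
  (mu (\big[setU/set0]_(t <- s | Q t) C t) <= \sum_(t <- s | Q t) mu (C t))%E.
Proof.
move=> mC; elim: s => [|t s IHs]; first by rewrite !big_nil measure0.
rewrite !big_cons; case: ifP => // _.
apply: le_trans (measureU2 _ _ _) _ => //; first exact: bigsetU_measurable.
by rewrite leeD2l.
Qed.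

End measurability.

(** * The decoding error as a countable union of pairwise confusions *)

Section channel.
Context (R : realType) d (Omega : measurableType d) (P : probability Omega R).
Variables (n : nat) (H z : 'I_n -> Omega -> R).
Hypothesis mH : forall i, measurable_fun setT (H i).
Hypothesis mz : forall i, measurable_fun setT (z i).
Hypothesis H0 : forall i w, 0 < H i w.

(** After translation by the sent point: the receiver prefers the competitor that differs from it by
    [y]. *)
Definition closer_set (y : 'I_n -> R) : set Omega :=
  [set w | \sum_i (H i w * y i - z i w) ^+ 2 < \sum_i z i w ^+ 2].

Lemma measurable_closer_set y : measurable (closer_set y).
Proof.
apply: measurable_lt_set; apply: measurable_sum => i; apply: measurable_funX => //.
by apply: measurable_funB => //; apply: measurable_funM.
Qed.

Lemma enorm_lt (v w : 'I_n -> R) :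
  (enorm v < enorm w) = (\sum_i v i ^+ 2 < \sum_i w i ^+ 2).
Proof.
have ge0 (x : 'I_n -> R) : 0 <= \sum_i x i ^+ 2.
  by apply: sumr_ge0 => i _; exact: sqr_ge0.
by rewrite !ltNge /enorm ler_sqrt.
Qed.

(** A lattice is invariant under translation by its points, so the event is the same for every [lam]
    and average and maximal error agree. Indexing by [{ffun 'I_n -> int}] keeps the union
    countable. *)
Lemma error_eventE (G : 'M[R]_n) lam : lattice G lam ->
  error_event G H z lam =
  \bigcup_(k : {ffun 'I_n -> int}) closer_set (lattice_pt G k).
Proof.
move=> [k0 ->]; apply/seteqP; split => w /=.
  move=> /existsNP[_ /not_implyP[[_ [k ->] <-]]] /negP.
  rewrite -ltNge enorm_lt => lt.
  (* The difference between the competitor and the sent point, in lattice coordinates. *)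
  exists [ffun i => k i - k0 i] => //; rewrite /closer_set/=.
  move: lt; rewrite (eq_bigr (fun i => (H i w *
    lattice_pt G [ffun i => k i - k0 i] i - z i w) ^+ 2)) => [|i _].
    congr (_ < _); apply: eq_bigr => i _; congr (_ ^+ 2).
    by rewrite /diag_act; ring.
  rewrite /diag_act -[LHS]sqrrN; congr (_ ^+ 2).
  have -> : lattice_pt G [ffun i => k i - k0 i] i =
      lattice_pt G k i - lattice_pt G k0 i.
    rewrite /lattice_pt -sumrB; apply: eq_bigr => j _.
    by rewrite ffunE rmorphB/= mulrBr.
  by ring.
move=> [k _]; rewrite /closer_set/= => lt vor.
have /vor : (diag_act (fun i => H i w) @` lattice G)
    (diag_act (fun i => H i w) (lattice_pt G (fun i => k i + k0 i))).
  by exists (lattice_pt G (fun i => k i + k0 i)) => //; eexists.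
apply/negP; rewrite -ltNge enorm_lt.
move: lt; congr (_ < _); apply: eq_bigr => i _; last first.
  by congr (_ ^+ 2); rewrite /diag_act; ring.
rewrite /diag_act -[RHS]sqrrN; congr (_ ^+ 2).
have -> : lattice_pt G (fun i => k i + k0 i) i =
    lattice_pt G k i + lattice_pt G k0 i.
  rewrite /lattice_pt -big_split/=; apply: eq_bigr => j _.
  by rewrite rmorphD/= mulrDr.
by ring.
Qed.

Lemma measurable_error_event (G : 'M[R]_n) lam : lattice G lam ->
  measurable (error_event G H z lam).
Proof.
move=> /error_eventE->; apply: countable_bigcupT_measurable => //.
by move=> k; exact: measurable_closer_set.
Qed.

End channel.

(** * Averaging the confusion probability under quiet noise and good fading *)

Section random_lattice.
Context (R : realType) d (Omega : measurableType d) (P : probability Omega R).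
Variables (m : nat) (H z : 'I_m.+1 -> Omega -> R) (r : R).
Hypothesis mH : forall i, measurable_fun setT (H i).
Hypothesis mz : forall i, measurable_fun setT (z i).
Hypothesis H0 : forall i w, 0 < H i w.
Hypothesis r0 : 0 < r.

Definition noisy : set Omega := [set w | r < enorm (fun i => z i w)].

Definition bad_fading (M : R) : set Omega :=
  \bigcup_(i : 'I_m.+1) ([set w | H i w <= M^-1] `|` [set w | M < H i w]).

Definition inv_det (w : Omega) : R := (\prod_i H i w)^-1.

Lemma inv_det_gt0 w : 0 < inv_det w.
Proof. by rewrite invr_gt0; apply: prodr_gt0. Qed.

Lemma measurable_inv_det : measurable_fun setT inv_det.
Proof.
apply: measurable_invr_gt0 => [w|]; first exact: prodr_gt0.
by apply: measurable_prod => i _.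
Qed.

Lemma noisyE : noisy = [set w | r ^+ 2 < \sum_i z i w ^+ 2].
Proof.
apply/seteqP; split => w /=.
  rewrite /noisy /= /enorm => rz; rewrite -[ltRHS]sqr_sqrtr; last first.
    by apply: sumr_ge0 => i _; exact: sqr_ge0.
  by rewrite ltr_pXn2r// nnegrE ?sqrtr_ge0// ltW.
move=> rz; rewrite /noisy/= /enorm -(ger0_norm (ltW r0)) -sqrtr_sqr.
by rewrite ltr_sqrt// (lt_trans _ rz)// exprn_gt0.
Qed.

Lemma measurable_noisy : measurable noisy.
Proof.
rewrite noisyE; apply: measurable_lt_set => //.
by apply: measurable_sum => i; apply: measurable_funX.
Qed.

Lemma measurable_bad_fading M : measurable (bad_fading M).
Proof.
apply: fin_bigcup_measurable => [|i _]; first exact: finite_finset.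
by apply: measurableU; [apply: measurable_le_set|apply: measurable_lt_set].
Qed.

(** The shift by [p] lets tuples over ['I_(p.*2)] enumerate all integer vectors with coordinates in
    [-p, p[. *)
Definition grid_pt (p : nat) {K : nat} (t : m.+1.-tuple 'I_K) : 'I_m.+1 -> int :=
  fun i => (tnth t i : nat)%:Z - p%:Z.

(* Outside the bad fading event, |y_i| < p is forced by the choice of alpha, so
   finitely many y matter. *)
Definition confusion (M alpha : R) (y : 'I_m.+1 -> int) : set Omega :=
  ~` bad_fading M `&` ~` noisy `&` closer_set H z (fun i => alpha * (y i)%:~R).

Lemma measurable_confusion M alpha y : measurable (confusion M alpha y).
Proof.
apply: measurableI; last exact: measurable_closer_set.
apply: measurableI; apply: measurableC; [exact: measurable_bad_fading|].
exact: measurable_noisy.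
Qed.

(** For fixed fading and noise, the points counted have alpha H y - z in the ball of radius [r].
    They form a grid with steps alpha H_i <= alpha M, to which the cell count applies. *)
Lemma sum_confusion_le (M alpha : R) (p K : nat) w : 0 < M -> 0 < alpha ->
  \sum_(t : m.+1.-tuple 'I_K) \1_(confusion M alpha (grid_pt p t)) w <=
  ball_vol R m.+1 * (r + m.+1%:R * (alpha * M)) ^+ m.+1 / alpha ^+ m.+1 *
  (\1_(~` noisy) w * inv_det w).
Proof.
move=> M0 alpha0.
have [wgood|wbad] := pselect ((~` bad_fading M `&` ~` noisy) w); last first.
  rewrite big1 => [|t _]; last by rewrite indicE memNset// => -[].
  apply: mulr_ge0; last by rewrite mulr_ge0// ltW// inv_det_gt0.
  apply: divr_ge0; last by rewrite exprn_ge0// ltW.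
  rewrite mulr_ge0//; first exact/ltW/ball_vol_gt0.
  by rewrite exprn_ge0// addr_ge0 ?mulr_ge0// ltW.
have [wM wr] := wgood.
have HM i : H i w <= M.
  by rewrite leNgt; apply/negP => MH; apply: wM; exists i => //; right.
rewrite indicE mem_set// mul1r.
have adet : 0 < alpha ^+ m.+1 * \prod_i H i w.
  by rewrite mulr_gt0 ?exprn_gt0//; apply: prodr_gt0.
rewrite /inv_det -mulrA -invfM ler_pdivlMr// mulrC.
(* Grid steps and offsets; the offset absorbs the noise and the shift in [grid_pt]. *)
pose b i := alpha * H (inord i) w.
pose c i := - (b i * p%:R) - z (inord i) w.
have -> : alpha ^+ m.+1 * \prod_i H i w = \prod_(i < m.+1) b i.
  rewrite /b big_split/= prodr_const card_ord; congr (_ * _).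
  by apply: eq_bigr => i _; rewrite inord_val.
apply: le_trans (@prod_grid_count_le_ball_vol R m.+1 K r (alpha * M) b c r0 _ _).
- rewrite ler_pM2l; last first.
    by apply: prodr_gt0 => i _; rewrite mulr_gt0.
  apply: ler_sum => t _; rewrite indicE; case: (boolP (_ \in _)) => //.
  rewrite inE => -[_]; rewrite /closer_set/= => closer.
  suff -> : \sum_(i < m.+1) (c i + b i * (tnth t i)%:R) ^+ 2 <= r ^+ 2 by [].
  have zr : \sum_i z i w ^+ 2 <= r ^+ 2.
    by move: wr; rewrite noisyE /= => /negP; rewrite -leNgt.
  rewrite (le_trans _ zr)// (le_trans _ (ltW closer))// le_eqVlt.
  apply/orP; left; apply/eqP/eq_bigr => i _; congr (_ ^+ 2).
  by rewrite /c /b inord_val /grid_pt rmorphB/=; ring.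
- by rewrite mulr_ge0// ltW.
- by move=> i; rewrite /b mulr_gt0//= ler_pM2l.
Qed.

(** If 0 and a competitor x are both within [r] of the noise, then alpha H_i |x_i| <= 2 r. With H_i
    > 1/M this forces |x_i| < p, so [modular_class_coord] applies. *)
Lemma error_event_sub (M alpha : R) (p : nat) (u : {ffun 'I_m -> 'I_p}) lam : prime p ->
  0 < M -> 0 < alpha -> 2 * r * M <= alpha * p%:R ->
  lattice (modular_gen alpha u) lam ->
  error_event (modular_gen alpha u) H z lam `<=`
  noisy `|` (bad_fading M `|`
    \big[setU/set0]_(t : m.+1.-tuple 'I_(p.*2) | modular_class u (grid_pt p t))
       confusion M alpha (grid_pt p t)).
Proof.
move=> p_prime M0 alpha0 pbig /(error_eventE H z)-> w [k _].
have [|wr] := pselect (noisy w); first by left.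
have [|wM] := pselect (bad_fading M w); first by right; left.
set x := modular_coord u k => closer; right; right.
have {}closer : closer_set H z (fun i => alpha * (x i)%:~R) w.
  move: closer; rewrite /closer_set/=; congr (_ < _).
  by apply: eq_bigr => i _; rewrite modular_gen_pt.
have zr : \sum_i z i w ^+ 2 <= r ^+ 2.
  by move: wr; rewrite noisyE /= => /negP; rewrite -leNgt.
have le_r (v : 'I_m.+1 -> R) i : \sum_i v i ^+ 2 <= r ^+ 2 -> `|v i| <= r.
  move=> vr; rewrite -ler_sqr ?nnegrE ?(ltW r0)//= real_normK ?num_real//.
  apply: le_trans vr; rewrite (bigD1 i)//= lerDl.
  by apply: sumr_ge0 => j _; exact: sqr_ge0.
have xp i : `|x i| < p%:Z.
  have zi := le_r _ i zr.
  have vi := le_r _ i (le_trans (ltW closer) zr).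
  have v2r : `|H i w * (alpha * (x i)%:~R)| <= 2 * r.
    by move: zi vi; rewrite !ler_norml => /andP[? ?] /andP[? ?]; apply/andP; lra.
  have HM : M^-1 < H i w.
    by rewrite ltNge; apply/negP => HM; apply: wM; exists i => //; left.
  move: v2r; rewrite !normrM (gtr0_norm (H0 i w)) (gtr0_norm alpha0) => v2r.
  rewrite -(ltr_int R) intr_norm -pmulrn -(ltr_pM2l alpha0).
  (* The strictness of H_i > 1/M survives multiplication only by a nonzero |x_i|, so zero is treated
     apart. *)
  apply: lt_le_trans pbig; have [->|x0] := eqVneq (x i) 0.
    by rewrite normr0 mulr0 !mulr_gt0.
  rewrite -ltr_pdivrMr// mulrC; apply: lt_le_trans v2r.
  by rewrite ltr_pM2r// mulr_gt0// normr_gt0 intr_eq0.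
have x0 : exists i, x i != 0.
  apply: contrapT => allx0; move: closer; rewrite /closer_set/=.
  rewrite (eq_bigr (fun i => z i w ^+ 2)) ?ltxx// => i _.
  have -> : x i = 0 by apply/eqP/negPn/negP => xi; apply: allx0; exists i.
  by rewrite mulr0 mulr0 sub0r sqrrN.
have xK i : (absz (x i + p%:Z)%R < p.*2)%N by have := xp i; lia.
pose t := [tuple Ordinal (xK i) | i < m.+1].
have tx : grid_pt p t = x.
  by apply/funext => i; rewrite /grid_pt tnth_mktuple/=; have := xp i; lia.
rewrite (bigD1 t)/=; last by rewrite tx modular_class_coord.
by left; split; [split|rewrite tx].
Qed.

Lemma sum_prob_confusion_le (M alpha A : R) (p K : nat) : 0 < M -> 0 < alpha ->
  (\int[P]_w (\1_(~` noisy) w * inv_det w)%:E <= A%:E)%E ->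
  \sum_(t : m.+1.-tuple 'I_K) fine (P (confusion M alpha (grid_pt p t))) <=
  ball_vol R m.+1 * (r + m.+1%:R * (alpha * M)) ^+ m.+1 / alpha ^+ m.+1 * A.
Proof.
move=> M0 alpha0 intA; rewrite -lee_fin -sumEFin.
rewrite (eq_bigr (fun t : m.+1.-tuple 'I_K =>
   \int[P]_w (\1_(confusion M alpha (grid_pt p t)) w)%:E)%E); last first.
  move=> t _; rewrite integral_indic//; last exact: measurable_confusion.
  by rewrite setIT fineK// fin_num_measure//; exact: measurable_confusion.
rewrite -ge0_integral_sum//; last first.
- by move=> t; apply/measurable_EFinP/measurable_indic/measurable_confusion.
have C0 : 0 <= ball_vol R m.+1 * (r + m.+1%:R * (alpha * M)) ^+ m.+1 /
    alpha ^+ m.+1.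
  apply: divr_ge0; last by rewrite exprn_ge0// ltW.
  rewrite mulr_ge0//; first exact/ltW/ball_vol_gt0.
  by rewrite exprn_ge0// addr_ge0 ?mulr_ge0// ltW.
have mf : measurable_fun setT (fun w => (\1_(~` noisy) w * inv_det w)%:E).
  apply/measurable_EFinP; apply: measurable_funM; last exact: measurable_inv_det.
  by apply/measurable_indic/measurableC/measurable_noisy.
rewrite EFinM; apply: le_trans (lee_wpmul2l _ intA); last by rewrite lee_fin.
rewrite -ge0_integralZl//; last first.
  by move=> w _; rewrite lee_fin mulr_ge0// ltW// inv_det_gt0.
apply: ge0_le_integral => //.
- by move=> w _; apply: sume_ge0 => t _; rewrite lee_fin.
- apply: emeasurable_sum => t.
  by apply/measurable_EFinP/measurable_indic/measurable_confusion.
- exact: measurable_funeM.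
- by move=> w _; rewrite sumEFin -EFinM lee_fin sum_confusion_le.
Qed.

(** The weights in [exists_light_class] are the confusion probabilities. The cover from
    [error_event_sub] does not mention [lam], so one [u] serves all sent points. *)
Lemma exists_good_lattice (M alpha A : R) (p : nat) : prime p ->
  0 < M -> 0 < alpha -> 2 * r * M <= alpha * p%:R ->
  (\int[P]_w (\1_(~` noisy) w * inv_det w)%:E <= A%:E)%E ->
  exists u : {ffun 'I_m -> 'I_p}, forall lam, lattice (modular_gen alpha u) lam ->
    (P (error_event (modular_gen alpha u) H z lam) <=
     P noisy + (P (bad_fading M) +
       (ball_vol R m.+1 * (r + m.+1%:R * (alpha * M)) ^+ m.+1 /
         (alpha ^+ m.+1 * p%:R ^+ m) * A)%:E))%E.
Proof.
move=> p_prime M0 alpha0 pbig intA.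
have w0 (t : m.+1.-tuple 'I_(p.*2)) :
    0 <= fine (P (confusion M alpha (grid_pt p t))) by exact: fine_ge0.
have [u ule] := exists_light_class p_prime (fun t => grid_pt p t) w0.
exists u => lam Glam.
pose U := \big[setU/set0]_(t : m.+1.-tuple 'I_(p.*2) |
  modular_class u (grid_pt p t)) confusion M alpha (grid_pt p t).
have mU : measurable U.
  by apply: bigsetU_measurable => t _; exact: measurable_confusion.
have mB := measurable_bad_fading M.
apply: (@le_trans _ _ (P (noisy `|` (bad_fading M `|` U)))).
  apply: le_measure; rewrite ?inE.
  - exact: measurable_error_event.
  - by apply: measurableU; [exact: measurable_noisy|exact: measurableU].
  - exact: error_event_sub.
apply: le_trans (measureU2 _ _ _) _; [exact: measurable_noisy|exact: measurableU|].
apply: leeD2l; apply: le_trans (measureU2 _ _ _) _ => //; apply: leeD2l.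
apply: le_trans (measure_bigsetU_le _ _ _ _) _ => [t|].
  exact: measurable_confusion.
rewrite (eq_bigr (fun t => (fine (P (confusion M alpha (grid_pt p t))))%:E)); last first.
  by move=> t _; rewrite fineK// fin_num_measure//; exact: measurable_confusion.
have pm0 : 0 < p%:R ^+ m :> R by rewrite exprn_gt0// ltr0n prime_gt0.
rewrite sumEFin lee_fin -(ler_pM2l pm0); apply: le_trans ule _.
apply: le_trans (sum_prob_confusion_le _ _ M0 alpha0 intA) _.
rewrite le_eqVlt; apply/orP; left; apply/eqP; field.
by rewrite (gt_eqF pm0) gt_eqF ?exprn_gt0.
Qed.

End random_lattice.

(** * Small probability of bad fading, and the strict gap left by loud noise *)

Section slack.
Import numFieldNormedType.Exports.
Context (R : realType) d (Omega : measurableType d) (P : probability Omega R).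
Variables (m : nat) (H z : 'I_m.+1 -> Omega -> R) (r : R).
Hypothesis mH : forall i, measurable_fun setT (H i).
Hypothesis mz : forall i, measurable_fun setT (z i).
Hypothesis H0 : forall i w, 0 < H i w.
Hypothesis r0 : 0 < r.

(** The bad events decrease to the empty set as the truncation level grows, each H_i being positive
    and finite; continuity from above concludes. *)
Lemma prob_bad_fading_small (e : R) : 0 < e ->
  exists2 M : R, 0 < M & (P (bad_fading H M) <= e%:E)%E.
Proof.
move=> e0; pose F (k : nat) := bad_fading H (k.+1%:R).
have mF k : measurable (F k) by exact: measurable_bad_fading.
have F0 : \bigcap_k F k = set0.
  rewrite -subset0 => w Fw.
  (* A level beyond both H_i and 1/H_i makes coordinate i good. *)
  pose k i := maxn (Num.trunc (H i w)) (Num.trunc (H i w)^-1).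
  have [i _ ik] := Fw (\max_i k i)%N I.
  have kle := leq_bigmax i (F := k).
  have H0i := H0 i w.
  case: ik => /=.
    rewrite leNgt => /negP; apply; rewrite -[ltRHS]invrK ltf_pV2 ?posrE ?invr_gt0//.
    rewrite (lt_le_trans (truncnS_gt _))// ler_nat ltnS.
    exact: leq_trans (leq_maxr _ _) kle.
  rewrite ltNge => /negP; apply; rewrite (le_trans (ltW (truncnS_gt _)))// ler_nat ltnS.
  exact: leq_trans (leq_maxl _ _) kle.
have cvgF : P \o F @ \oo --> (0 : \bar R)%E.
  rewrite -(measure0 P) -F0; apply: nonincreasing_cvg_mu => //.
  - by rewrite (le_lt_trans (probability_le1 _ _))// ltry.
  - by rewrite F0.
  - move=> k l kl; apply/subsetPset => w [i _ wi]; exists i => //.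
    case: wi => /= wi; [left|right] => /=.
      by rewrite (le_trans wi)// lef_pV2 ?posrE// ler_nat.
    by rewrite (le_lt_trans _ wi)// ler_nat.
have /fine_cvgP[_ /cvgrPdist_le cvgF'] := cvgF.
have [N _ /(_ N (leqnn N))] := cvgF' _ e0.
rewrite /= sub0r normrN ger0_norm ?fine_ge0// => PN.
exists N.+1%:R => //; rewrite -(fineK (fin_num_measure P _ (mF N))).
by rewrite lee_fin.
Qed.

(** One coordinate in ]r, r + 1] already makes the noise longer than [r], and the Gaussian density
    is bounded below there. *)
Lemma prob_noisy_gt0 (sigma : R) : 0 < sigma ->
  (forall i (A : set R), measurable A ->
    P (z i @^-1` A) = normal_prob 0 sigma A) ->
  (0 < P (noisy z r))%E.
Proof.
move=> sigma0 /(_ ord0 `]r, r + 1]%classic (measurable_itv _)) Pz.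
apply: (@lt_le_trans _ _ (P (z ord0 @^-1` `]r, r + 1]%classic))); last first.
  apply: le_measure; rewrite ?inE.
  - by rewrite -[_ @^-1` _]setTI; exact: mz.
  - exact: measurable_noisy.
  - move=> w /=; rewrite in_itv/= => /andP[rz _].
    rewrite noisyE//= (bigD1 ord0)//=; apply: (@lt_le_trans _ _ (z ord0 w ^+ 2)).
      by rewrite ltr_pXn2r ?nnegrE ?(ltW r0)// ltW// (lt_trans r0).
    by rewrite lerDl; apply: sumr_ge0 => j _; exact: sqr_ge0.
rewrite Pz /normal_prob.
(* The density at r + 1, its minimum on the interval. *)
pose c := normal_peak sigma * expR (- (r + 1) ^+ 2 / (sigma ^+ 2 *+ 2)).
have c0 : 0 < c by rewrite mulr_gt0 ?expR_gt0// normal_peak_gt0// gt_eqF.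
apply: (@lt_le_trans _ _ (\int[lebesgue_measure]_(x in `]r, (r + 1)%R]) c%:E)%E).
  rewrite integral_cst//= lebesgue_measure_itv/= lte_fin ltrDl ltr01.
  by rewrite -EFinB -EFinM lte_fin mulr_gt0// addrAC subrr add0r.
apply: ge0_le_integral => //=.
- by move=> x _; rewrite lee_fin ltW.
- by apply/measurable_EFinP/measurable_funTS; exact: measurable_normal_pdf.
move=> x; rewrite in_itv/= => /andP[rx xr]; rewrite lee_fin.
rewrite normal_pdfE ?gt_eqF// ler_wpM2l ?normal_peak_ge0// /normal_fun subr0.
rewrite ler_expR ler_wpM2r ?invr_ge0 ?mulrn_wge0 ?sqr_ge0// lerN2.
by rewrite ler_pXn2r// nnegrE ?addr_ge0 ?(ltW r0)// (le_trans (ltW r0))// ltW.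
Qed.

(* This strict gap absorbs all the errors of the lattice averaging argument. *)
Lemma integral_quiet_lt : (0 < P (noisy z r))%E ->
  (\int[P]_w (inv_det H w)%:E < +oo)%E ->
  (\int[P]_w (\1_(~` noisy z r) w * inv_det H w)%:E <
   \int[P]_w (inv_det H w)%:E)%E.
Proof.
move=> noisy0 fin.
have mN := measurable_noisy mz r0.
have mq : measurable_fun setT (fun w => (inv_det H w)%:E).
  by apply/measurable_EFinP; exact: measurable_inv_det.
have q0 w : (0 <= (inv_det H w)%:E)%E by rewrite lee_fin ltW// inv_det_gt0.
have split A : measurable A -> (\int[P]_w (\1_A w * inv_det H w)%:E =
    \int[P]_(w in A) (inv_det H w)%:E)%E.
  move=> mA; rewrite [RHS]integral_mkcond; apply: eq_integral => w _.
  by rewrite patchE indicE; case: (_ \in _); rewrite ?mul1r ?mul0r.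
rewrite split; last exact: measurableC.
move: fin; rewrite -(setUv (noisy z r)) ge0_integral_setU//; last 3 first.
- exact: measurableC.
- by rewrite setUv.
- by rewrite disj_set2E setICr.
move=> fin.
(* Cancelling the finite quiet part leaves the integral over [noisy]. Were it 0, the positive
   [inv_det] would vanish almost everywhere on an event of positive probability. *)
rewrite -[ltLHS]add0e lteD2rE; last first.
  rewrite ge0_fin_numE; last exact: integral_ge0.
  by apply: le_lt_trans fin; rewrite leeDr//; exact: integral_ge0.
rewrite lt0e integral_ge0// andbT; apply/negP => /eqP int0.
have : (\int[P]_(w in noisy z r) `|(inv_det H w)%:E| = 0)%E.
  by rewrite -[RHS]int0; apply: eq_integral => w _; rewrite gee0_abs.
move=> /(ae_eq_integral_abs _ mN (measurable_funTS mq)).1 [N [mN' N0 sub]].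
move: noisy0; rewrite ltNge => /negP; apply; rewrite -N0.
apply: le_measure; rewrite ?inE// => w wn; apply: sub => /= /(_ wn) [] q00.
by have := inv_det_gt0 H0 w; rewrite q00 ltxx.
Qed.

End slack.

(** * Elementary estimates and the choice of alpha and p *)

Lemma exprD_le_linear (R : realType) (r : R) n : 0 <= r ->
  exists2 C : R, 0 < C &
    forall e, 0 <= e <= 1 -> (r + e) ^+ n <= r ^+ n + C * e.
Proof.
move=> r0; elim: n => [|n [C C0 IHn]].
  by exists 1 => // e /andP[e0 _]; rewrite !expr0 lerDl mul1r.
(* Expand (r + e) (r^n + C e) and use e^2 <= e. *)
exists (r * C + r ^+ n + C); first by rewrite ltr_wpDl// addr_ge0 ?mulr_ge0 ?exprn_ge0// ltW.
move=> e e01; have := IHn e e01; case/andP: e01 => e0 e1 le.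
rewrite !exprS; apply: (@le_trans _ _ ((r + e) * (r ^+ n + C * e))).
  by rewrite ler_wpM2l// addr_ge0.
have : C * e * e <= C * e by rewrite ler_piMr// mulr_ge0// ltW.
lra.
Qed.

Lemma r_eff_ratio (R : realType) n (r gamma D : R) : (0 < n)%N ->
  0 < gamma -> 0 < D ->
  (r / r_eff n gamma D) ^+ n = ball_vol R n * gamma * r ^+ n / D.
Proof.
move=> n0 gamma0 D0; have V0 := ball_vol_gt0 R n.
have x0 : 0 < D / (gamma * ball_vol R n) by rewrite divr_gt0// mulr_gt0.
rewrite expr_div_n /r_eff -[(_ `^ _) ^+ n]powR_mulrn ?powR_ge0// -powRrM mulVf; last first.
  by rewrite pnatr_eq0 -lt0n.
rewrite powRr1 ?ltW//; field.
by rewrite !gt_eqF.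
Qed.

Lemma modular_density_param (R : realType) m (gamma : R) p :
  0 < gamma -> (0 < p)%N ->
  exists2 alpha : R, 0 < alpha & alpha ^+ m.+1 * p%:R ^+ m = gamma^-1.
Proof.
move=> gamma0 p0; have pm0 : 0 < p%:R ^+ m :> R by rewrite exprn_gt0// ltr0n.
have x0 : 0 < (gamma * p%:R ^+ m)^-1 by rewrite invr_gt0 mulr_gt0.
exists ((gamma * p%:R ^+ m)^-1 `^ m.+1%:R^-1); first exact: powR_gt0.
rewrite -powR_mulrn ?powR_ge0// -powRrM mulVf ?pnatr_eq0// powRr1 ?ltW//.
by field; rewrite !gt_eqF.
Qed.

Lemma modular_fine_param (R : realType) m (gamma B eta : R) : (0 < m)%N ->
  0 < gamma -> 0 < B -> 0 < eta ->
  exists p, exists2 alpha : R, prime p /\ 0 < alpha <= eta &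
    alpha ^+ m.+1 * p%:R ^+ m = gamma^-1 /\ B <= alpha * p%:R.
Proof.
move=> m0 gamma0 B0 eta0.
(* The density constraint gives (alpha p)^(m+1) = p / gamma, whence the first threshold. It also
   gives alpha^(m+1) = 1 / (gamma p^m), at most 1 / (gamma p) since m > 0, whence the second. *)
pose N := Num.max (gamma * B ^+ m.+1) (gamma * eta ^+ m.+1)^-1.
have [p pN p_prime] := prime_above (Num.trunc N).
have {}pN : N < p%:R by rewrite (lt_le_trans (truncnS_gt _))// ler_nat.
move: pN; rewrite /N gt_max => /andP[pB peta].
have p0 : 0 < p%:R :> R by rewrite ltr0n prime_gt0.
have [alpha alpha0 alphap] :=
  modular_density_param m gamma0 (prime_gt0 p_prime).
exists p, alpha; split=> //.
  rewrite alpha0/= -(@ler_pXn2r _ m.+1)// ?nnegrE ?(ltW alpha0) ?(ltW eta0)//.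
  have pm0 : 0 < p%:R ^+ m :> R by rewrite exprn_gt0.
  rewrite -(ler_pM2r pm0) alphap -(ler_pM2l gamma0) mulfV ?gt_eqF//.
  move: peta; rewrite -[ltLHS]mul1r ltr_pdivrMr; last first.
    by rewrite mulr_gt0// exprn_gt0.
  move=> /ltW /le_trans; apply; rewrite mulrC mulrA ler_wpM2l//.
    by rewrite mulr_ge0 ?exprn_ge0// ltW.
  by rewrite ler_eXnr// ler1n prime_gt0.
rewrite -(@ler_pXn2r _ m.+1)// ?nnegrE ?mulr_ge0 ?(ltW alpha0) ?(ltW B0)//.
rewrite exprMn [p%:R ^+ _]exprSr mulrA alphap.
by rewrite -(ler_pM2l gamma0) mulrA mulfV ?gt_eqF// mul1r ltW.
Qed.

(** * The error bound when E[1 / det H] is infinite or finite *)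

Section bound.
Context (R : realType) d (Omega : measurableType d) (P : probability Omega R).
Variables (m : nat) (H z : 'I_m.+1 -> Omega -> R) (r gamma : R).
Hypothesis mH : forall i, measurable_fun setT (H i).
Hypothesis mz : forall i, measurable_fun setT (z i).
Hypothesis H0 : forall i w, 0 < H i w.
Hypothesis r0 : 0 < r.
Hypothesis gamma0 : 0 < gamma.

Local Notation c := (ball_vol R m.+1 * gamma * r ^+ m.+1).

Local Notation bounded_error G := (forall lam, lattice G lam ->
  (P (error_event G H z lam) <=
   P (noisy z r) + \int[P]_w (c * inv_det H w)%:E)%E).

Lemma bound_gt0 : 0 < c.
Proof. by rewrite !mulr_gt0 ?exprn_gt0 ?ball_vol_gt0. Qed.

Lemma integral_bound :
  (\int[P]_w (c * inv_det H w)%:E = c%:E * \int[P]_w (inv_det H w)%:E)%E.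
Proof.
rewrite -ge0_integralZl//.
- by apply/measurable_EFinP; exact: measurable_inv_det.
- by move=> w _; rewrite lee_fin ltW// inv_det_gt0.
by rewrite lee_fin ltW// bound_gt0.
Qed.

Lemma modular_lattice_density (alpha : R) p (u : {ffun 'I_m -> 'I_p}) :
  0 < alpha -> alpha ^+ m.+1 * p%:R ^+ m = gamma^-1 ->
  lattice_density (modular_gen alpha u) = gamma.
Proof.
move=> alpha0 alphap; rewrite /lattice_density det_modular_gen alphap.
by rewrite gtr0_norm ?invr_gt0// invrK.
Qed.

(** The right-hand side is infinite, so only the density matters; p = 1 gives a scaled integer
    lattice. *)
Lemma exists_lattice_infinite : (\int[P]_w (inv_det H w)%:E = +oo)%E ->
  exists2 G : 'M[R]_m.+1, lattice_density G = gamma & bounded_error G.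
Proof.
move=> intoo; have [alpha alpha0 alphap] :=
  modular_density_param m gamma0 (ltn0Sn 0).
exists (modular_gen alpha [ffun=> ord0 : 'I_1]).
  exact: modular_lattice_density.
move=> lam _; rewrite integral_bound intoo gt0_muley ?lte_fin ?bound_gt0//.
by rewrite addey ?leey// gt_eqF// (lt_le_trans _ (measure_ge0 _ _)) ?ltNy0.
Qed.

(* With 0 < m, alpha tends to 0 as p grows; for m = 0 the lattice of given
   density is unique. *)
Lemma exists_lattice_finite (A E : R) : (0 < m)%N -> A < E ->
  (\int[P]_w (\1_(~` noisy z r) w * inv_det H w)%:E = A%:E)%E ->
  (\int[P]_w (inv_det H w)%:E = E%:E)%E ->
  exists2 G : 'M[R]_m.+1, lattice_density G = gamma & bounded_error G.
Proof.
move=> m0 AE intA intE.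
have A0 : 0 <= A.
  rewrite -lee_fin -intA; apply: integral_ge0 => w _.
  by rewrite lee_fin mulr_ge0// ltW// inv_det_gt0.
have c0 := bound_gt0; pose V := ball_vol R m.+1 * gamma.
have V0 : 0 < V by rewrite mulr_gt0 ?ball_vol_gt0.
(* The available gap: one half pays for bad fading, the other for enlarging the radius [r]. *)
pose s := c * (E - A).
have s0 : 0 < s / 2 by rewrite divr_gt0// mulr_gt0// subr_gt0.
have [M M0 badM] := prob_bad_fading_small P mH H0 s0.
have [C C0 rC] := exprD_le_linear m.+1 (ltW r0).
(* Chosen so that V C e A <= s / 2; [A + 1] avoids dividing by 0 when [A] is 0, and the cap 1 is the
   range of [exprD_le_linear]. *)
pose e := Num.min 1 (s / 2 / (V * C * (A + 1))).
have VCA : 0 < V * C * (A + 1) by rewrite (mulr_gt0 (mulr_gt0 V0 C0))// ltr_wpDl.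
have e0 : 0 < e by rewrite lt_min ltr01/= divr_gt0.
(* Below this value of alpha, the enlargement (m + 1) alpha M is at most [e]. *)
have eta0 : 0 < e / (m.+1%:R * M) by rewrite divr_gt0// mulr_gt0.
have B0 : 0 < 2 * r * M by rewrite !mulr_gt0.
have [p [alpha [p_prime /andP[alpha0 alphae]] [alphap alphaB]]] :=
  modular_fine_param m0 gamma0 B0 eta0.
have intA' : (\int[P]_w (\1_(~` noisy z r) w * inv_det H w)%:E <= A%:E)%E.
  by rewrite intA.
have [u Gu] :=
  exists_good_lattice mH mz H0 r0 p_prime M0 alpha0 alphaB intA'.
exists (modular_gen alpha u); first exact: modular_lattice_density.
move=> lam /Gu /le_trans; apply; rewrite leeD2l// integral_bound intE.
apply: le_trans (leeD2r _ badM) _; rewrite -EFinD -EFinM lee_fin alphap invrK.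
set rho := r + _; have rho_le : rho ^+ m.+1 <= r ^+ m.+1 + C * e.
  apply: (@le_trans _ _ ((r + e) ^+ m.+1)).
    rewrite ler_pXn2r ?nnegrE ?addr_ge0 ?mulr_ge0 ?(ltW r0) ?(ltW e0) ?(ltW M0)//;
      last exact: ltW.
    rewrite lerD2l; move: alphae; rewrite ler_pdivlMr ?mulr_gt0//.
    by rewrite mulrCA mulrA mulrC.
  by apply: rC; rewrite (ltW e0) ge_min lexx.
have eCA : V * C * e * A <= s / 2.
  apply: (@le_trans _ _ (V * C * e * (A + 1))).
    by rewrite (ler_wpM2l (ltW (mulr_gt0 (mulr_gt0 V0 C0) e0)))// lerDl.
  by rewrite mulrAC -ler_pdivlMl// [_^-1 * _]mulrC /e ge_min lexx orbT.
have : V * rho ^+ m.+1 * A <= V * (r ^+ m.+1 + C * e) * A.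
  by rewrite ler_wpM2r// ler_wpM2l// ltW.
have cE : c = V * r ^+ m.+1 by [].
have sE : s = V * r ^+ m.+1 * E - V * r ^+ m.+1 * A by rewrite /s cE; ring.
have -> : ball_vol R m.+1 * rho ^+ m.+1 * gamma * A = V * rho ^+ m.+1 * A.
  by rewrite /V; ring.
rewrite cE; lra.
Qed.

End bound.

(** * Dimension one, by Markov's inequality *)

Section dimension_one.
Context (R : realType) d (Omega : measurableType d) (P : probability Omega R).
Variables (H z : 'I_1 -> Omega -> R) (r gamma : R).
Hypothesis mH : forall i, measurable_fun setT (H i).
Hypothesis mz : forall i, measurable_fun setT (z i).
Hypothesis H0 : forall i w, 0 < H i w.
Hypothesis r0 : 0 < r.
Hypothesis gamma0 : 0 < gamma.

(** A confusable point is a nonzero multiple of H / gamma of size at most 2 r, so H / gamma itself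
    is at most 2 r. *)
Lemma error_event_dim1_sub lam : lattice (gamma^-1)%:M lam ->
  error_event (gamma^-1)%:M H z lam `<=`
  noisy z r `|` [set w | H ord0 w <= 2 * gamma * r].
Proof.
move=> /(error_eventE H z)-> w [k _].
rewrite /closer_set /= !big_ord1 /lattice_pt big_ord1 mxE eqxx mulr1n => closer.
have [|wr] := pselect (noisy z r w); [by left|right => /=].
have {wr} : z ord0 w ^+ 2 <= r ^+ 2.
  by move: wr; rewrite noisyE//= big_ord1 => /negP; rewrite -leNgt.
rewrite -[z _ _ ^+ 2]real_normK ?num_real// ler_pXn2r ?nnegrE ?(ltW r0)// => zr.
have k0 : k ord0 != 0.
  by apply/eqP => k0; move: closer; rewrite k0 !mulr0 sub0r sqrrN ltxx.
have k1 : 1 <= `|(k ord0)%:~R : R|.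
  by rewrite -intr_norm ler1z; move: k0; lia.
pose v := H ord0 w * (gamma^-1 * (k ord0)%:~R).
have : `|v - z ord0 w| < `|z ord0 w|.
  rewrite -(@ltr_pXn2r _ 2)// ?nnegrE//.
  by rewrite !real_normK ?num_real.
move=> closer'; have v2r : `|v| <= 2 * r.
  have := ler_normD (v - z ord0 w) (z ord0 w); rewrite subrK; lra.
move: v2r; rewrite /v !normrM (gtr0_norm (H0 _ _)) gtr0_norm ?invr_gt0// => v2r.
apply: (@le_trans _ _ (H ord0 w * `|(k ord0)%:~R|)).
  by rewrite ler_peMr// ltW.
have -> : H ord0 w * `|(k ord0)%:~R| =
    gamma * (H ord0 w * (gamma^-1 * `|(k ord0)%:~R|)).
  by field; rewrite gt_eqF.
by rewrite [2 * gamma]mulrC -mulrA ler_pM2l.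
Qed.

Lemma exists_lattice_dim1 :
  exists2 G : 'M[R]_1, lattice_density G = gamma &
    forall lam, lattice G lam ->
    (P (error_event G H z lam) <= P (noisy z r) +
      \int[P]_w (ball_vol R 1 * gamma * r ^+ 1 * inv_det H w)%:E)%E.
Proof.
exists (gamma^-1)%:M.
  by rewrite /lattice_density det_scalar expr1 gtr0_norm ?invr_gt0// invrK.
move=> lam Glam; pose A := [set w | H ord0 w <= 2 * gamma * r].
have mA : measurable A by exact: measurable_le_set.
have mN := measurable_noisy mz r0.
apply: (@le_trans _ _ (P (noisy z r `|` A))).
  apply: le_measure; rewrite ?inE.
  - exact: measurable_error_event.
  - exact: measurableU.
  - exact: error_event_dim1_sub.
apply: le_trans (measureU2 _ _ _) _ => //; apply: leeD2l.
(* On the event H <= 2 gamma r, the integrand V_1 gamma r / H is at least 1 because V_1 >= 2. *)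
apply: (@le_trans _ _ (\int[P]_w (\1_A w)%:E)%E).
  by rewrite integral_indic// setIT.
have q0 w := inv_det_gt0 H0 w.
have V2 := ball_vol1 R.
have c0 : 0 <= ball_vol R 1 * gamma * r ^+ 1.
  exact/ltW/bound_gt0.
apply: ge0_le_integral => //.
- by apply/measurable_EFinP; exact: measurable_indic.
- apply/measurable_EFinP; apply: measurable_funM => //.
  exact: measurable_inv_det.
move=> w _; rewrite lee_fin indicE; case: (boolP (w \in A)) => [|_]; last first.
  by rewrite mulr_ge0// ltW.
rewrite inE /A/= => Hw; rewrite /inv_det big_ord1 ler_pdivlMr// mul1r.
by rewrite (le_trans Hw)// expr1 ler_pM2r// ler_pM2r.
Qed.

End dimension_one.

(** * Assembly of the cases and the form with the effective radius *)

Unset Implicit Arguments.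

Theorem theorem4p5 (R : realType) (d : measure_display) (Omega : measurableType d)
  (P : probability Omega R) (n : nat) (H z : 'I_n -> Omega -> R)
  (sigma r gamma : R) :
  (0 < n)%N -> 0 < r -> 0 < gamma -> 0 < sigma ->
  (forall i, measurable_fun setT (H i)) ->
  (forall i, measurable_fun setT (z i)) ->
  (forall i w, 0 < H i w) ->
  (forall i j (A : set R), measurable A -> P (H i @^-1` A) = P (H j @^-1` A)) ->
  (forall i (A : set R), measurable A -> P (z i @^-1` A) = normal_prob 0 sigma A) ->
  mutually_independent P (channel_rvs H z) ->
  exists G : 'M[R]_n,
    lattice_density G = gamma /\
    (forall lam, lattice G lam ->
      (P (error_event G H z lam) <=
         P [set w | (r < enorm (fun i => z i w))%R] +
         \int[P]_w ((ball_vol R n * gamma * r ^+ n / \prod_i H i w)%R%:E))%E) /\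
    (\int[P]_w ((ball_vol R n * gamma * r ^+ n / \prod_i H i w)%R%:E) =
     \int[P]_w (((r / r_eff n gamma (\prod_i H i w)) ^+ n)%R%:E))%E.
Proof.
move=> n0 r0 gamma0 sigma0 mH mz H0 _ zP _.
have [G Gdensity Gerr] : exists2 G : 'M[R]_n, lattice_density G = gamma &
    forall lam, lattice G lam ->
    (P (error_event G H z lam) <= P [set w | (r < enorm (fun i => z i w))%R] +
      \int[P]_w ((ball_vol R n * gamma * r ^+ n / \prod_i H i w)%R%:E))%E.
  case: n n0 => // -[|m] _ in H z mH mz H0 zP *.
    exact: exists_lattice_dim1.
  have [intoo|intE] := eqVneq (\int[P]_w (inv_det H w)%:E)%E +oo%E.
    exact: exists_lattice_infinite.
  have int0 (f : Omega -> R) : (forall w, 0 <= f w) ->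
      (0 <= \int[P]_w (f w)%:E)%E.
    by move=> f0; apply: integral_ge0 => w _; rewrite lee_fin.
  have q0 w : 0 <= inv_det H w by rewrite ltW// inv_det_gt0.
  have intEoo : (\int[P]_w (inv_det H w)%:E < +oo)%E by rewrite ltey.
  have AE := integral_quiet_lt mH mz H0 r0
    (prob_noisy_gt0 mz r0 sigma0 zP) intEoo.
  have fE := ge0_fin_numE (int0 _ q0); rewrite intEoo in fE.
  have fA : (\int[P]_w (\1_(~` noisy z r) w * inv_det H w)%:E)%E \is a fin_num.
    rewrite ge0_fin_numE; first exact: lt_trans AE intEoo.
    by apply: int0 => w; rewrite mulr_ge0.
  apply: (exists_lattice_finite mH mz H0 r0 gamma0 (ltn0Sn m) _
    (esym (fineK fA)) (esym (fineK fE))).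
  by rewrite -lte_fin !fineK.
exists G; split=> //; split=> //.
apply: eq_integral => w _; rewrite r_eff_ratio//.
exact: prodr_gt0.
Qed.
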